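(* Let $n\ge 1$ and $k\ge 1$ be integers, let $\Bbbk$ be a field, and let $H=P_n^c$ be the antipath on the vertices $x_1,\ldots,x_n$. Then the $k$-th power $I(H)^k\subset \Bbbk[x_1,\ldots,x_n]$ of the edge ideal of $H$ has linear quotients under the lex ordering of its generators; that is, listing the minimal monomial generators of $I(H)^k$ in decreasing lexicographic order with respect to $x_1>x_2>\cdots>x_n$ gives a linear quotients ordering.
   Context: The antipath $P_n^c$ is the complement of the path $P_n$ with vertices $x_1,\ldots,x_n$ and edges $\{x_i,x_{i+1}\}$, $1\le i\le n-1$; thus $\{x_i,x_j\}$ with $i<j$ is an edge of $P_n^c$ if and only if $j\ge i+2$. For a simple graph $G$ on vertices $x_1,\ldots,x_n$, the edge ideal $I(G)\subset\Bbbk[x_1,\ldots,x_n]$ is the squarefree monomial ideal generated by the products $x_ix_j$ over all edges $\{x_i,x_j\}$ of $G$. A monomial ideal $I$ has linear quotients if its minimal monomial generators can be ordered $m_1,m_2,\ldots,m_r$ so that for every $i>1$ the colon ideal $(m_1,\ldots,m_{i-1}):(m_i)$ is generated by a subset of the variables; such an ordering is called a linear quotients ordering of $I$. *)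

(* Defs.v *)
From mathcomp Require Import all_boot all_order all_algebra.
From mathcomp Require Import mpoly.

Set Implicit Arguments.
Unset Strict Implicit.
Unset Printing Implicit Defensive.

Import Order.TTheory GRing.Theory.
Local Open Scope ring_scope.

(* Ideals are Prop-valued predicates: the idealr structure of ring_quotient
   only covers proper ideals with decidable membership. *)
Section Ideals.
Variable R : comNzRingType.
Implicit Types (S I J : R -> Prop).

Definition ideal_eq I J := forall f, I f <-> J f.

Definition ideal_gen S : R -> Prop := fun f =>
  exists r : seq (R * R),
    (forall p, p \in r -> S p.2) /\ f = \sum_(p <- r) p.1 * p.2.

Definition ideal_mul I J : R -> Prop :=
  ideal_gen (fun f => exists g h, [/\ I g, J h & f = g * h]).

Definition ideal_exp I (k : nat) : R -> Prop :=
  iter k (ideal_mul I) (fun=> True).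

Definition ideal_colon I J : R -> Prop := fun f => forall g, J g -> I (f * g).

End Ideals.

Section MonomialIdeals.
Variables (K : fieldType) (n : nat).
Implicit Types (I : {mpoly K[n]} -> Prop) (s : seq 'X_{1..n}).

Definition monomial_ideal (A : {pred 'X_{1..n}}) : {mpoly K[n]} -> Prop :=
  ideal_gen (fun f => exists2 m, m \in A & f = 'X_[m]).

Definition variable_ideal (V : {set 'I_n}) : {mpoly K[n]} -> Prop :=
  ideal_gen (fun f => exists2 j, j \in V & f = 'X_j).

(* Since generation is monotone, the last clause says that no proper subset
   of s generates I. *)
Definition minimal_monomial_generators I s :=
  [/\ uniq s,
      ideal_eq (monomial_ideal (mem s)) I &
      forall m, m \in s ->
        ~ ideal_eq (monomial_ideal [predD1 s & m]) I].

(* Positions are counted from 0, so nth 0%MM s i is the monomial m_(i+1). *)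
Definition linear_quotients_ordering I s :=
  minimal_monomial_generators I s /\
  forall i, (0 < i < size s)%N ->
    exists V : {set 'I_n},
      ideal_eq (ideal_colon (monomial_ideal (mem (take i s)))
                            (monomial_ideal (pred1 (nth 0%MM s i))))
               (variable_ideal V).

End MonomialIdeals.

(* Pure lexicographic order with x_1 > x_2 > ... > x_n on exponent tuples; the
   order that mpoly puts on 'X_{1..n} compares total degrees first. *)
Definition lex_gt (n : nat) : rel 'X_{1..n} :=
  fun m1 m2 =>
    ((m2 : n.-tuple nat) < (m1 : n.-tuple nat) :> n.-tuplelexi nat)%O.

Lemma lex_gtP n (m1 m2 : 'X_{1..n}) :
  reflect (exists2 i : 'I_n,
             (m2 i < m1 i)%N & forall j : 'I_n, (j < i)%N -> m1 j = m2 j)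
          (lex_gt m1 m2).
Proof.
rewrite /lex_gt; apply: (iffP idP) => [|[i ltm eqm]].
  move/Order.TupleLexiOrder.ltxi_tuplePlt => [i eqm ltm]; exists i => //.
  by move=> j /eqm /esym.
apply/Order.TupleLexiOrder.ltxi_tuplePlt.
by exists i => // j /eqm /esym.
Qed.

(* The vertex x_(i+1) is i : 'I_n; a simple graph is a symmetric irreflexive
   relation. *)
Definition path_graph (n : nat) : rel 'I_n :=
  fun i j => (j == i.+1 :> nat) || (i == j.+1 :> nat).

Definition graph_compl (n : nat) (e : rel 'I_n) : rel 'I_n :=
  fun i j => (i != j) && ~~ e i j.

Definition antipath (n : nat) : rel 'I_n := graph_compl (@path_graph n).

Lemma antipath_sym n : ssrbool.symmetric (@antipath n).
Proof. by move=> i j; rewrite /antipath /graph_compl /path_graph eq_sym orbC. Qed.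

Lemma antipath_irrefl n : ssrbool.irreflexive (@antipath n).
Proof. by move=> i; rewrite /antipath /graph_compl eqxx. Qed.

Lemma antipath_ltE n (i j : 'I_n) :
  (i < j)%N -> antipath i j = (i + 2 <= j)%N.
Proof.
move=> ltij; rewrite /antipath /graph_compl /path_graph negb_or -val_eqE /=.
rewrite neq_ltn ltij /= (@ltn_eqF i j.+1) ?andbT; last exact: ltn_trans ltij _.
by rewrite addn2 [RHS]ltn_neqAle ltij andbT eq_sym.
Qed.

Definition edge_ideal (K : fieldType) (n : nat) (e : rel 'I_n) :
    {mpoly K[n]} -> Prop :=
  ideal_gen (fun f => exists i j, e i j /\ f = 'X_i * 'X_j).

Arguments edge_ideal K {n} e.

(* Main.v *)
(* With windows {x_c, x_(c+1)} of two consecutive vertices, a monomial of degree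
   2k is a product of k edges of the antipath iff no window carries more than k
   of its 2k variables: a window is independent in the antipath, and conversely
   one writes the variables in increasing order a_1 <= ... <= a_2k and pairs
   a_i with a_(i+k).  If u is lexicographically larger than v, x_p is the first
   variable where they differ and x_q the first variable after x_p dividing v,
   then x_p v / x_q still satisfies the window conditions; since it precedes v
   and x_p divides u / gcd(u, v), the colon ideals are generated by variables. *)
Require Import Defs.
From mathcomp Require Import all_boot all_order all_algebra.
From mathcomp Require Import mpoly.
From mathcomp Require Import zify.

Set Implicit Arguments.
Unset Strict Implicit.
Unset Printing Implicit Defensive.

Import Order.TTheory GRing.Theory.
Local Open Scope ring_scope.

(** * Ideals generated by a set, and their products *)

Section Ideals.
Variable R : comNzRingType.
Implicit Types (S I J : R -> Prop) (f g h : R).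

Lemma ideal_gen_mem S f : S f -> ideal_gen S f.
Proof.
move=> Sf; exists [:: (1, f)]; split; first by move=> p /[!inE] /eqP ->.
by rewrite big_seq1 mul1r.
Qed.

Lemma ideal_gen0 S : ideal_gen S 0.
Proof. by exists [::]; split=> //; rewrite big_nil. Qed.

Lemma ideal_genD S f g : ideal_gen S f -> ideal_gen S g -> ideal_gen S (f + g).
Proof.
move=> [r [Sr ->]] [r' [Sr' ->]]; exists (r ++ r'); rewrite big_cat; split=> //.
by move=> p; rewrite mem_cat => /orP[/Sr|/Sr'].
Qed.

Lemma ideal_genM S f g : ideal_gen S g -> ideal_gen S (f * g).
Proof.
move=> [r [Sr ->]]; exists [seq (f * p.1, p.2) | p <- r]; split.
  by move=> _ /mapP[p /Sr Sp ->].
by rewrite big_map mulr_sumr; apply: eq_bigr => p _; rewrite mulrA.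
Qed.

Lemma ideal_gen_sum S (T : eqType) (r : seq T) (F : T -> R) :
  (forall x, x \in r -> ideal_gen S (F x)) -> ideal_gen S (\sum_(x <- r) F x).
Proof.
move=> SF; rewrite big_seq; apply: big_ind => //; first exact: ideal_gen0.
exact: ideal_genD.
Qed.

Lemma ideal_gen_min S S' :
  (forall f, S f -> ideal_gen S' f) -> forall f, ideal_gen S f -> ideal_gen S' f.
Proof.
move=> SS' _ [r [Sr ->]]; apply: ideal_gen_sum => p /Sr /SS'.
exact: ideal_genM.
Qed.

Lemma ideal_mul_gen S S' I J :
  ideal_eq I (ideal_gen S) -> ideal_eq J (ideal_gen S') ->
  ideal_eq (ideal_mul I J)
           (ideal_gen (fun f => exists g h, [/\ S g, S' h & f = g * h])).
Proof.
move=> eqI eqJ f; split; apply: ideal_gen_min => {}f [g [h []]].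
  move=> /eqI [r [Sr ->]] /eqJ [r' [Sr' ->]] ->.
  rewrite mulr_suml; apply: ideal_gen_sum => p /Sr Sp.
  rewrite mulr_sumr; apply: ideal_gen_sum => p' /Sr' Sp'.
  rewrite mulrACA; apply: ideal_genM; apply: ideal_gen_mem.
  by exists p.2, p'.2.
move=> Sg Sh ->; apply: ideal_gen_mem; exists g, h.
by split=> //; [apply/eqI | apply/eqJ]; apply: ideal_gen_mem.
Qed.

End Ideals.

(** * Monomial ideals, their colons and linear quotients *)

Section MonomialIdeals.
Variables (K : fieldType) (n : nat).
Implicit Types (P : 'X_{1..n} -> Prop) (f : {mpoly K[n]}) (m u v w : 'X_{1..n}).
Implicit Types (s : seq 'X_{1..n}).

(** A multiple of a monomial only has support divisible by it; conversely, expand [f] into its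
    terms, each a multiple of some generator. *)
Lemma monomial_genP P f :
  ideal_gen (fun g => exists2 m, P m & g = 'X_[m]) f <->
  forall m, m \in msupp f -> exists2 u, P u & (u <= m)%MM.
Proof.
split=> [[r [Pr ->]] m|Pf].
  move=> /msupp_sum_le /flattenP[_ /mapP[p pr ->]] /msuppM_le.
  rewrite mem_filter in pr; have /Pr[u Pu ->] := pr.
  move=> /allpairsP[[a b] /= [_]]; rewrite msuppX inE => /eqP -> ->.
  by exists u => //; rewrite addmC; apply: lem_addr.
rewrite (mpolyE f); apply: ideal_gen_sum => m /Pf[u Pu le_um].
rewrite -(submK le_um) mpolyXD -mul_mpolyC mulrA.
by apply: ideal_genM; apply: ideal_gen_mem; exists u.
Qed.

Lemma monomial_ideal_XP (A : {pred 'X_{1..n}}) m :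
  monomial_ideal (K := K) A 'X_[m] <-> exists2 u, u \in A & (u <= m)%MM.
Proof.
rewrite /monomial_ideal monomial_genP msuppX; split=> [|Am u].
  by apply; rewrite inE.
by rewrite inE => /eqP ->.
Qed.

Lemma mdeg_lepm_eq u m : (u <= m)%MM -> mdeg u = mdeg m -> u = m.
Proof.
move=> le_um; rewrite -[in mdeg m](submK le_um) mdegD.
move=> /eqP; rewrite -[X in X == _]add0n eqn_add2r eq_sym mdeg_eq0.
by move=> /eqP eq0; rewrite -(submK le_um) eq0 add0m.
Qed.

(** Distinct monomials of one degree never divide each other, so no generator is redundant. *)
Lemma equigenerated_minimal s d (I : {mpoly K[n]} -> Prop) :
  uniq s -> {in s, forall m, mdeg m = d} ->
  ideal_eq (monomial_ideal (mem s)) I -> minimal_monomial_generators I s.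
Proof.
move=> us degs eqI; split=> // m ms eqI'.
have /eqI/eqI' : monomial_ideal (K := K) (mem s) 'X_[m].
  by apply/monomial_ideal_XP; exists m; rewrite ?lepm_refl.
move=> /monomial_ideal_XP[u]; rewrite !inE => /andP[neq us'] le_um.
by move/eqP: neq; apply; apply: mdeg_lepm_eq => //; rewrite !degs.
Qed.

(** The first hypothesis puts the variables of [V] in the colon. For the converse, if [u] in [A]
    divides [v + m] and [v p < u p], then [x_p] must divide [m]. *)
Lemma colon_variable_ideal (A : {pred 'X_{1..n}}) (V : {set 'I_n}) v :
  (forall p, p \in V -> exists2 w, w \in A & (w <= v + U_(p))%MM) ->
  (forall u, u \in A -> exists2 p, p \in V & (v p < u p)%N) ->
  ideal_eq (ideal_colon (monomial_ideal (K := K) A) (monomial_ideal (pred1 v)))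
           (variable_ideal V).
Proof.
move=> AV VA f; split=> [colf|].
  have /monomial_genP Af : monomial_ideal A (f * 'X_[v]).
    by apply: colf; apply/monomial_ideal_XP; exists v; rewrite ?inE ?lepm_refl.
  have /monomial_genP : forall m, m \in msupp f ->
      exists2 u, (exists2 p, p \in V & u = U_(p)%MM) & (u <= m)%MM.
    move=> m mf; have /Af[u Au /mnm_lepP le_u] : (v + m)%MM \in msupp (f * 'X_[v]).
      by rewrite mcoeff_msupp mcoeffMX -mcoeff_msupp.
    have [p pV lt_p] := VA u Au; exists U_(p)%MM; first by exists p.
    by apply/mnm_lepP => i; have := le_u i; rewrite mnmDE mnm1E;
       case: eqP => // <-; lia.
  apply: ideal_gen_min => _ [_ [p pV ->] ->].
  by apply: ideal_gen_mem; exists p.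
move=> Vf g [r [rv ->]].
rewrite mulr_sumr; apply: ideal_gen_sum => x /rv[m /[!inE] /eqP -> ->].
rewrite mulrCA; apply: ideal_genM; case: Vf => r' [r'V ->].
rewrite mulr_suml; apply: ideal_gen_sum => y /r'V[p pV ->].
rewrite -mulrA -mpolyXD; apply: ideal_genM.
by apply/monomial_ideal_XP; rewrite addmC; apply: AV.
Qed.

Lemma linear_quotients_of_exchange s d (I : {mpoly K[n]} -> Prop) :
  uniq s -> {in s, forall m, mdeg m = d} ->
  ideal_eq (monomial_ideal (mem s)) I ->
  (forall i u, (i < size s)%N -> u \in take i s ->
     exists w p, [/\ w \in take i s, (w <= nth 0%MM s i + U_(p))%MM &
                     (nth 0%MM s i p < u p)%N]) ->
  linear_quotients_ordering I s.
Proof.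
move=> us degs eqI exch; split; first exact: equigenerated_minimal degs eqI.
move=> i /andP[_ lt_i]; set v := nth _ _ _.
(* The largest candidate: every [p] such that [x_p v] lies in the ideal of the earlier
   generators. *)
exists [set p | has (fun w => (w <= v + U_(p))%MM) (take i s)].
apply: colon_variable_ideal => [p|u us'].
  by rewrite inE => /hasP[w]; exists w.
have [w [p [ws le_w lt_p]]] := exch i u lt_i us'.
by exists p => //; rewrite inE; apply/hasP; exists w.
Qed.

End MonomialIdeals.

(** * Monomial generators of powers of an edge ideal *)

Section EdgeProducts.
Variables (n : nat) (e : rel 'I_n).

Definition edge_product k (m : 'X_{1..n}) :=
  exists t : seq ('I_n * 'I_n),
    [/\ size t = k, all (fun x => e x.1 x.2) t &
        m = (\sum_(x <- t) (U_(x.1) + U_(x.2)))%MM].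

Lemma edge_ideal_exp (K : fieldType) k :
  ideal_eq (ideal_exp (edge_ideal K e) k)
           (ideal_gen (fun f => exists2 m, edge_product k m & f = 'X_[m])).
Proof.
elim: k => [|k IHk] f.
  (* The zeroth power is the whole ring, generated by the empty edge product 1. *)
  split=> // _; apply/monomial_genP => m _; exists 0%MM.
    by exists [::]; rewrite big_nil.
  by apply/mnm_lepP => i; rewrite mnm0E.
have eqI : ideal_eq (edge_ideal K e) (edge_ideal K e) by [].
apply: iff_trans (ideal_mul_gen eqI IHk f) _.
split; apply: ideal_gen_min => {}f.
  move=> [_ [_ [[i [j [eij ->]]] [m [t [st et ->]] ->] ->]]].
  apply: ideal_gen_mem; rewrite -!mpolyXD.
  exists (U_(i) + U_(j) + \sum_(x <- t) (U_(x.1) + U_(x.2)))%MM => //.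
  by exists ((i, j) :: t); rewrite big_cons /= st eij.
case=> _ [[|[i j] t] [//= [st] + ->]] -> => /andP[eij et].
rewrite big_cons mpolyXD; apply: ideal_gen_mem.
exists 'X_[U_(i) + U_(j)], 'X_[\sum_(x <- t) (U_(x.1) + U_(x.2))].
split=> //; first by exists i, j; rewrite mpolyXD.
by exists (\sum_(x <- t) (U_(x.1) + U_(x.2)))%MM => //; exists t.
Qed.

End EdgeProducts.

(** * The window criterion for antipaths and the exchange property *)

Section Windows.
Variable n : nat.
Implicit Types (m u v w : 'X_{1..n}) (c : nat) (i j p q : 'I_n).

Definition in_window c : pred 'I_n := fun i => (c <= i <= c.+1)%N.

Definition window m c : nat := \sum_(i | in_window c i) m i.

(** The window at [c = n - 1] is cut down to the last vertex alone; for [n = 1] and [k > 0] it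
    excludes every monomial, as it should without edges. *)
Definition balanced k m : bool :=
  (mdeg m == k.*2) && [forall c : 'I_n, (window m c <= k)%N].

Lemma windowD u v c : window (u + v)%MM c = (window u c + window v c)%N.
Proof.
by rewrite -big_split; apply: eq_bigr => i _; rewrite mnmDE.
Qed.

Lemma window1 p c : window U_(p)%MM c = in_window c p.
Proof.
rewrite /window; under eq_bigr do rewrite mnm1E.
case: (boolP (in_window c p)) => [cp|ncp].
  rewrite (bigD1 p) //= eqxx big1 // => i /andP[_ /negPf].
  by rewrite eq_sym => ->.
by rewrite big1 // => i ci; case: eqP => // eq_pi; rewrite eq_pi ci in ncp.
Qed.

Lemma window0 c : window 0%MM c = 0%N.
Proof. by rewrite /window big1 // => i _; rewrite mnm0E. Qed.

Lemma window_sum (t : seq 'I_n) c :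
  window (\sum_(i <- t) U_(i))%MM c = count (in_window c) t.
Proof.
elim: t => [|i t IHt]; first by rewrite big_nil window0.
by rewrite big_cons windowD window1 IHt.
Qed.

Lemma edge_product_balanced k m :
  edge_product (@antipath n) k m -> balanced k m.
Proof.
move=> [t [<- et ->]]; apply/andP; split.
  rewrite mdeg_sum; under eq_bigr do rewrite mdegD !mdeg1.
  by rewrite big_const_seq count_predT iter_addn_0 mulnC muln2.
apply/forallP => c; elim: t et => [|[i j] t IHt] /=.
  by rewrite big_nil window0.
rewrite big_cons !windowD !window1 => /andP[eij /IHt].
by move: eij; rewrite /antipath /graph_compl /path_graph /in_window -val_eqE /=;
   lia.
Qed.

Lemma sorted_variables m :
  exists2 t : seq 'I_n, sorted (relpre val leq) t & m = (\sum_(i <- t) U_(i))%MM.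
Proof.
pose t := flatten [seq nseq (m i) i | i <- enum 'I_n].
exists (sort (relpre val leq) t).
  by apply: sort_sorted => i j; apply: leq_total.
rewrite (perm_big t) ?perm_sort //= big_flatten big_map big_enum /=.
rewrite {1}[m]multinomUE_id; apply: eq_bigr => i _.
by rewrite big_nseq /mnm_muln Monoid.iteropE.
Qed.

(** If the sorted entries at positions [i] and [i + k] were not adjacent, the [k + 1] entries from
    one to the other would crowd into a single window. *)
Lemma balanced_edge_product k m :
  balanced k m -> edge_product (@antipath n) k m.
Proof.
have [t sorted_t ->] := sorted_variables m => /andP[].
rewrite mdeg_sum; under eq_bigr do rewrite mdeg1.
rewrite sum1_size => /eqP size_t /forallP window_t.
have take_k : size (take k t) = k by rewrite size_takel // size_t; lia.
have drop_k : size (drop k t) = k by rewrite size_drop size_t; lia.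
exists (zip (take k t) (drop k t)); split.
- by rewrite size_zip take_k drop_k minnn.
(* A nonempty [t] supplies the default [x0] for [nth]; ['I_n] itself may be empty. *)
- case: (t =P [::]) => [->|]; first by [].
  case Dt : {1}t => [//|x0 t'] _.
  apply/(all_nthP (x0, x0)) => i.
  rewrite size_zip take_k drop_k minnn => lt_ik.
  rewrite nth_zip ?take_k ?drop_k //= nth_take // nth_drop.
  have nth_le a b : (a <= b < k.*2)%N -> (nth x0 t a <= nth x0 t b)%N.
    move=> /andP[le_ab lt_b].
    have le_tr : transitive (relpre (val : 'I_n -> nat) leq).
      by move=> ? ? ?; apply: leq_trans.
    apply: (sorted_leq_nth le_tr _ x0 sorted_t); rewrite ?inE ?size_t //.
    exact: leq_ltn_trans lt_b.
  set x := nth x0 t i; set y := nth x0 t (k + i).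
  have [lt_xy|le_yx] := leqP (x + 2) y.
    by rewrite antipath_ltE //; lia.
  (* Here [y <= x + 1], so by sortedness positions [i] to [i + k] all fall in the window starting at
     [x]. *)
  have all_x : all (in_window x) (take k.+1 (drop i t)).
    apply/(all_nthP x0) => j; rewrite size_take_min size_drop size_t => lt_j.
    rewrite nth_take ?nth_drop; last by lia.
    rewrite /in_window /x nth_le; last by lia.
    have /nth_le le_y : (i + j <= k + i < k.*2)%N by lia.
    by rewrite (leq_trans le_y) // -/y -/x -ltnS -addn2.
  have := window_t x; rewrite window_sum leqNgt => /negP[].
  rewrite -[t](cat_take_drop i) count_cat -[drop i t](cat_take_drop k.+1) count_cat.
  move: all_x; rewrite all_count => /eqP ->.
  by rewrite size_take_min size_drop size_t; lia.
- rewrite big_split /= -(big_map fst xpredT (fun i => U_(i)%MM)).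
  rewrite -(big_map snd xpredT (fun i => U_(i)%MM)) -/(unzip1 _) -/(unzip2 _).
  rewrite unzip1_zip ?unzip2_zip ?take_k ?drop_k //.
  by rewrite -big_cat cat_take_drop.
Qed.

Lemma ltn_sum_at (P : pred 'I_n) (f g : 'I_n -> nat) p :
  (forall i, P i -> f i <= g i)%N -> P p -> (f p < g p)%N ->
  (\sum_(i | P i) f i < \sum_(i | P i) g i)%N.
Proof.
move=> le_fg Pp lt_p; rewrite (bigD1 p) //= [ltnRHS](bigD1 p) //=.
rewrite -addSn leq_add // leq_sum // => i /andP[Pi _]; exact: le_fg.
Qed.

Lemma balanced_exchange k u v :
  balanced k u -> balanced k v -> lex_gt u v ->
  exists w p, [/\ balanced k w, lex_gt w v, (w <= v + U_(p))%MM & (v p < u p)%N].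
Proof.
move=> /andP[/eqP degu /forallP winu] /andP[/eqP degv /forallP winv].
move=> /lex_gtP[p lt_p eq_p].
(* Otherwise [v] vanishes after [p], agrees with [u] before [p] and is smaller at [p], against the
   equality of degrees. *)
have [q0 q0P] : exists q, (p < q)%N && (0 < v q)%N.
  apply/existsP; apply: contraT; rewrite negb_exists => /forallP v0.
  have : (mdeg v < mdeg u)%N.
    rewrite !mdegE; apply: (ltn_sum_at (p := p)) => // i _.
    have := v0 i; case: (ltngtP i p) => [/eq_p ->|lt_pi|/val_inj ->] //=; lia.
  by rewrite degu degv ltnn.
case: (@arg_minnP _ q0 [pred q : 'I_n | (p < q)%N && (0 < v q)%N] val q0P) => q.
move=> /= /andP[lt_pq vq] min_q.
have le_q : (U_(q) <= v + U_(p))%MM.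
  apply/mnm_lepP => i; rewrite mnmDE !mnm1E; case: eqP => // <-.
  by rewrite addn_gt0 vq.
(* [w] is [x_p v / x_q]. Since subtraction truncates, everything below is read off the additive
   identity [Dw]. *)
have Dw := submK le_q; set w := (v + U_(p) - U_(q))%MM in Dw.
have wE i : (w i + (q == i) = v i + (p == i))%N.
  by rewrite -!mnm1E -!mnmDE Dw.
exists w, p; split=> //.
- apply/andP; split.
    have /(congr1 (@mdeg n)) := Dw; rewrite !mdegD !mdeg1 degv.
    by move=> /eqP; rewrite eqn_add2r.
  apply/forallP => c; have /(congr1 (window^~ c)) := Dw.
  rewrite /= !windowD !window1.
  case: (boolP (in_window c p)) => cp; last by have := winv c; lia.
  case: (boolP (in_window c q)) => cq; first by have := winv c; lia.
  (* Only a window with [p] but not [q] gains. By minimality of [q], [v] vanishes on its vertices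
     after [p], so there [v] is dominated by [u], strictly at [p]. *)
  suff : (window v c < window u c)%N by have := winu c; lia.
  apply: (ltn_sum_at (p := p)) => // j cj.
  case: (ltngtP j p) => [/eq_p ->|lt_pj|/val_inj ->] //; last exact: ltnW.
  case: (posnP (v j)) => [-> //|vj].
  have := min_q j; rewrite lt_pj vj => /(_ isT).
  by move: cp cq cj; rewrite /in_window; lia.
- apply/lex_gtP; exists p => [|j lt_jp].
    by have := wE p; rewrite eqxx -!val_eqE /=; lia.
  by have := wE j; rewrite -!val_eqE /=; lia.
- by rewrite -Dw lem_addr.
Qed.

End Windows.

(** * Lists in decreasing lexicographic order *)

Lemma lex_gt_trans n : transitive (@lex_gt n).
Proof. by move=> y x z xy yz; apply: lt_trans yz xy. Qed.

Lemma lex_gt_irr n : irreflexive (@lex_gt n).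
Proof. by move=> x; apply: ltxx. Qed.

(** Monomials of degree [d] live in the finite type ['X_{1..n < d.+1}], so they can be enumerated,
    sorted increasingly and reversed. *)
Lemma lex_sorted_enum n d (A : pred 'X_{1..n}) :
  (forall m, A m -> mdeg m = d) ->
  exists2 s, sorted (@lex_gt n) s & s =i A.
Proof.
move=> degA; pose l := [seq val m | m <- enum {: 'X_{1..n < d.+1}} & A (val m)].
have ul : uniq l.
  by rewrite map_inj_uniq ?filter_uniq -?enumT ?enum_uniq //; apply: val_inj.
(* The cast selects the pure lexicographic order rather than the degree-first one on ['X_{1..n}]. *)
pose tup (m : 'X_{1..n}) : n.-tuplelexi nat := m.
exists (rev (sort (relpre tup <=%O) l)).
  have : sorted <%O (map tup (sort (relpre tup <=%O) l)).
    by rewrite -sort_map sort_lt_sorted map_inj_uniq // => m m' /val_inj.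
  by rewrite rev_sorted sorted_map.
move=> m; rewrite mem_rev mem_sort; apply/mapP/idP => [[m']|Am].
  by rewrite mem_filter => /andP[Am' _] ->.
have lt_m : (mdeg m < d.+1)%N by rewrite degA.
by exists (BMultinom lt_m) => //; rewrite mem_filter mem_enum andbT.
Qed.

(** Turns membership among the earlier generators into a lexicographic comparison, the form in which
    the exchange property applies. *)
Lemma mem_take_sorted (T : eqType) (r : rel T) x0 (s : seq T) i x :
  transitive r -> irreflexive r -> sorted r s -> (i < size s)%N ->
  (x \in take i s) = (x \in s) && r x (nth x0 s i).
Proof.
move=> r_tr r_irr; rewrite sorted_pairwise // => rs lt_i.
have Ds : s = take i s ++ nth x0 s i :: drop i.+1 s.
  by rewrite -drop_nth // cat_take_drop.
have -> : (x \in s) = (x \in take i s) || (x \in nth x0 s i :: drop i.+1 s).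
  by rewrite -mem_cat -Ds.
move: rs; rewrite inE {1}Ds pairwise_cat /=.
case/and3P=> /allrelP r1 _ /andP[/allP r2 _].
case: (boolP (x \in take i s)) => [xs|_] /=; first by rewrite r1 // mem_head.
case: eqP => [->|_] /=; first by rewrite r_irr.
case: (boolP (x \in drop _ _)) => //= /r2 rx; apply/esym/negP => rx'.
by have := r_tr _ _ _ rx rx'; rewrite r_irr.
Qed.

Theorem proposition3p1 (K : fieldType) (n k : nat)
    (hn : (1 <= n)%N) (hk : (1 <= k)%N) :
  exists s : seq 'X_{1..n},
    sorted (@lex_gt n) s /\
    linear_quotients_ordering (ideal_exp (edge_ideal K (@antipath n)) k) s.
Proof.
have deg_balanced (m : 'X_{1..n}) : balanced k m -> mdeg m = k.*2.
  by case/andP=> /eqP.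
(* The list enumerates the balanced monomials, which the window criterion identifies with the
   products of [k] edges. *)
have [s sorted_s sE] := lex_sorted_enum deg_balanced.
have take_s := mem_take_sorted 0%MM _ (@lex_gt_trans n) (@lex_gt_irr n) sorted_s.
exists s; split=> //; apply: (@linear_quotients_of_exchange _ _ _ k.*2).
- by apply: sorted_uniq sorted_s; [apply: lex_gt_trans | apply: lex_gt_irr].
- by move=> m; rewrite sE => /deg_balanced.
- move=> f; rewrite edge_ideal_exp.
  split; apply: ideal_gen_min => _ [m mP ->]; apply: ideal_gen_mem; exists m => //.
    by apply: balanced_edge_product; rewrite -[balanced k m]sE.
  by rewrite sE; apply: edge_product_balanced.
- move=> i u lt_i; rewrite take_s // sE => /andP[bu gt_u].
  have bv : balanced k (nth 0%MM s i) by rewrite -[balanced _ _]sE mem_nth.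
  have [w [p [bw gt_w le_w lt_p]]] := balanced_exchange bu bv gt_u.
  by exists w, p; split=> //; rewrite take_s // gt_w sE andbT.
Qed.
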